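(* $\mathcal{MC} \cap \mathcal{I}_{2,0} = \mathcal{SCP} \cap \mathcal{I}_{2,0}$.
   Context: An implicator groupoid is an algebra $\mathbf A = \langle A, \to, 0 \rangle$, with $\to$ binary and $0$ a constant, which, writing $x' := x \to 0$, satisfies the identities (I) $(x \to y) \to z \approx [(z' \to x) \to (y \to z)']'$ and (I$_0$) $0'' \approx 0$. Put $x \land y := (x \to y')'$. $\mathcal{I}_{2,0}$, $\mathcal{SCP}$, $\mathcal{MC}$ are the varieties of implicator groupoids satisfying, respectively, $x'' \approx x$; $x \to y \approx y' \to x'$; $x \land y \approx y \land x$. *)

(* Defs.v *)
From mathcomp Require Import classical_sets.

Set Implicit Arguments.
Unset Strict Implicit.
Unset Printing Implicit Defensive.

Declare Scope implicator_scope.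
Delimit Scope implicator_scope with imp.
Local Open Scope implicator_scope.

Reserved Notation "x ~> y" (at level 55, right associativity).
Reserved Notation "x ^'" (format "x ^'").

Record implicator_groupoid := ImplicatorGroupoid {
  carrier :> Type;
  imp : carrier -> carrier -> carrier;
  zero : carrier;
  axiom_I :
    let compl x := imp x zero in
    forall x y z : carrier,
      imp (imp x y) z =
      compl (imp (imp (compl z) x) (compl (imp y z)));
  axiom_I0 :
    let compl x := imp x zero in
    compl (compl zero) = zero
}.

Arguments zero {_}.
Notation "x ~> y" := (imp x y) : implicator_scope.

Definition compl (A : implicator_groupoid) (x : A) : A := x ~> zero.
Notation "x ^'" := (compl x) : implicator_scope.

Definition meet (A : implicator_groupoid) (x y : A) : A := (x ~> y^')^'.

Local Open Scope classical_set_scope.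

Definition I20 : set implicator_groupoid :=
  [set A : implicator_groupoid | forall x : A, x^'^' = x].

Definition SCP : set implicator_groupoid :=
  [set A : implicator_groupoid | forall x y : A, x ~> y = y^' ~> x^'].

Definition MC : set implicator_groupoid :=
  [set A : implicator_groupoid | forall x y : A, meet x y = meet y x].

(* Main.v *)
Require Import Defs.
From mathcomp Require Import ssreflect classical_sets.
Local Open Scope classical_set_scope.

(** When [x'' = x], priming is a bijection. Cancelling the outer prime in
    [(x -> y')' = (y -> x')'] turns commutativity of the meet into
    [x -> y' = y -> x'], and replacing [y] by [y'] turns this into the law of
    contraposition [x -> y = y' -> x']; both steps are reversible. *)

Theorem theorem5p3 : MC `&` I20 = SCP `&` I20.
Proof.
apply/seteqP; split=> A [/= hA inv]; split=> //= x y.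
- have contra : imp x (compl (compl y)) = imp (compl y) (compl x).
    by rewrite -[LHS]inv -[RHS]inv; congr compl; exact: hA.
  by rewrite -contra inv.
- by rewrite /meet hA inv.
Qed.
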